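(* Let $X$ be a real Banach space and $\{T_n:X\rightrightarrows X^*\}_{n\in\mathbb{N}}$ a sequence of maximal monotone operators of type (D). Then the lower limit $T=\liminf T_n$ is representable.
   Context: Operators are identified with their graphs; $\langle\cdot,\cdot\rangle$ is the duality pairing and $X\subset X^{**}$ canonically. Monotone: $\langle x-y,x^*-y^*\rangle\ge0$ on the graph; maximal monotone: not properly contained in a monotone operator. For maximal monotone $T$, $\widetilde T=\{(x^{**},x^* )\in X^{**}\times X^*: \langle x^{**}-y,x^*-y^*\rangle\ge 0\ \forall (y,y^* )\in T\}$; $T$ is of type (D) if each point of $\widetilde T$ is the weak$^*\times$norm limit of a bounded net in $T$. $\liminf T_n=\{(x,x^* ): \exists (y_n,y_n^* )\in T_n,\ (y_n,y_n^* )\to(x,x^* )\text{ in norm}\times\text{norm}\}$. An operator $T\subset X\times X^*$ is representable if there exists a convex, proper, (norm) lower semicontinuous $h:X\times X^*\to\mathbb{R}\cup\{+\infty\}$ with $h(x,x^* )\ge\langle x,x^*\rangle$ for all $(x,x^* )$ and $T=\{(x,x^* ): h(x,x^* )=\langle x,x^*\rangle\}$. *)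

(* Defs.v *)
From HB Require Import structures.
From mathcomp Require Import all_boot all_order all_algebra.
From mathcomp Require Import all_classical all_reals all_analysis.
Set Implicit Arguments. Unset Strict Implicit. Unset Printing Implicit Defensive.
Import Order.TTheory GRing.Theory Num.Theory.
Import numFieldNormedType.Exports.
Local Open Scope classical_set_scope.
Local Open Scope ring_scope.

Section Defs.
Variables (R : realType) (X : completeNormedModType R).

Definition in_dual (f : X -> R) : Prop :=
  (forall (a : R) (x y : X), f (a *: x + y) = a * f x + f y) /\ continuous f.

Definition dnorm (f : X -> R) : R :=
  sup [set `|f x| | x in [set x : X | `|x| <= 1]].

(* X^** : linear functionals on X^* bounded for the dual norm; only their
   values on X^* matter *)
Definition in_bidual (phi : (X -> R) -> R) : Prop :=
  (forall (a : R) (f g : X -> R), in_dual f -> in_dual g ->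
      phi (fun x => a * f x + g x) = a * phi f + phi g) /\
  exists C : R, forall f, in_dual f -> `|phi f| <= C * dnorm f.

(* an operator X =>> X^* is identified with its graph *)
Definition operator := set (X * (X -> R)).

Definition graph_in_XXs (T : operator) : Prop :=
  forall p, T p -> in_dual p.2.

Definition monotone (T : operator) : Prop :=
  forall p q, T p -> T q -> 0 <= (p.2 (p.1 - q.1)) - (q.2 (p.1 - q.1)).

Definition maximal_monotone (T : operator) : Prop :=
  graph_in_XXs T /\ monotone T /\
  forall S : operator, graph_in_XXs S -> monotone S -> T `<=` S -> S = T.

Definition Ttilde (T : operator) : set (((X -> R) -> R) * (X -> R)) :=
  [set p | in_bidual p.1 /\ in_dual p.2 /\
     forall q, T q -> 0 <= (p.1 (fun x => p.2 x - q.2 x)) - (p.2 q.1 - q.2 q.1)].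

Definition net_cvg (I : Type) (le : I -> I -> Prop) (a : I -> R) (l : R) : Prop :=
  forall eps : R, 0 < eps -> exists i0, forall i, le i0 i -> `|a i - l| < eps.

Definition directed (I : Type) (le : I -> I -> Prop) : Prop :=
  inhabited I /\ (forall i, le i i) /\
  (forall i j k, le i j -> le j k -> le i k) /\
  (forall i j, exists k, le i k /\ le j k).

Definition type_D (T : operator) : Prop :=
  maximal_monotone T /\
  forall p, Ttilde T p ->
    exists (I : Type) (le : I -> I -> Prop) (net : I -> X * (X -> R)),
      directed le /\
      (forall i, T (net i)) /\
      (exists M : R, forall i, `|(net i).1| <= M /\ dnorm (net i).2 <= M) /\
      (forall f, in_dual f -> net_cvg le (fun i => f (net i).1) (p.1 f)) /\
      net_cvg le (fun i => dnorm (fun x => (net i).2 x - p.2 x)) 0.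

Definition liminf_op (Tn : nat -> operator) : operator :=
  [set p | in_dual p.2 /\
     exists y : nat -> X * (X -> R),
       (forall n, Tn n (y n)) /\
       (fun n => (y n).1) @ \oo --> p.1 /\
       (fun n => dnorm (fun x => (y n).2 x - p.2 x)) @ \oo --> (0 : R)].

Definition convex_on_XXs (h : X * (X -> R) -> \bar R) : Prop :=
  forall (p q : X * (X -> R)) (t : R), in_dual p.2 -> in_dual q.2 -> 0 < t < 1 ->
    (h ((t *: p.1 + (1 - t) *: q.1)%R, fun x => (t * p.2 x + (1 - t) * q.2 x)%R)
    <= t%:E * h p + (1 - t)%:E * h q)%E.

Definition proper_on_XXs (h : X * (X -> R) -> \bar R) : Prop :=
  (forall p, in_dual p.2 -> h p != -oo%E) /\
  (exists p, in_dual p.2 /\ h p != +oo%E).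

Definition lsc_on_XXs (h : X * (X -> R) -> \bar R) : Prop :=
  forall p (a : R), in_dual p.2 -> (a%:E < h p)%E ->
    exists2 d : R, 0 < d & forall q, in_dual q.2 ->
      `|q.1 - p.1| < d -> dnorm (fun x => q.2 x - p.2 x) < d -> (a%:E < h q)%E.

Definition representable (T : operator) : Prop :=
  graph_in_XXs T /\
  exists h : X * (X -> R) -> \bar R,
    convex_on_XXs h /\ proper_on_XXs h /\ lsc_on_XXs h /\
    (forall p, in_dual p.2 -> ((p.2 p.1)%:E <= h p)%E) /\
    (forall p, in_dual p.2 -> (T p <-> h p = (p.2 p.1)%:E)).

End Defs.

(* Main.v *)
(** The lower limit is represented by the upper epi-limit [h] of the Fitzpatrick
    functions [phi_n] of the [T_n]: it is convex, lower semicontinuous and above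
    the duality pairing because the [phi_n] are, and it equals the pairing on
    the lower limit because [phi_n] equals the pairing on [T_n].

    Conversely, if [h] equals the pairing at [p], there are points [q_n -> p] at
    which [phi_n] exceeds the pairing by a vanishing amount, and a
    Brondsted-Rockafellar property moves [q_n] into [T_n] at a vanishing cost.
    That property comes from the fact that, for every translate of an operator
    of type (D), the infimum of [phi + (|x|^2 + |x^*|^2) / 2] is nonpositive: by
    Hahn-Banach, a positive infimum would give a point of [X^* x X^**] whose
    existence contradicts type (D). An approximate minimizer centred at [q] is
    at distance of order the square root of the gap at [q] and has an
    arbitrarily small gap, so that iterating and passing to the limit reaches a
    point with zero gap, that is, a point of the operator.

    When the lower limit is empty, [h] might be [+oo] everywhere; the function
    equal to [1] at the origin and [+oo] elsewhere then does the job. *)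

From HB Require Import structures.
From mathcomp Require Import all_boot all_order all_algebra.
From mathcomp Require Import all_classical all_reals all_analysis.
From mathcomp Require Import ring lra.
Require Import Defs.
Set Implicit Arguments. Unset Strict Implicit. Unset Printing Implicit Defensive.
Import Order.TTheory GRing.Theory Num.Theory.
Import numFieldNormedType.Exports.
Local Open Scope classical_set_scope.
Local Open Scope ring_scope.

(** * Infima of real families bounded below *)

Section InfimumOfFamily.
Variables (R : realType) (I : Type) (P : set I) (F : I -> R).

Lemma inf_image_le (b : R) (i : I) :
  (forall j, P j -> b <= F j) -> P i -> inf (F @` P) <= F i.
Proof.
move=> lbF Pi; apply: ge_inf; last by exists i.
by exists b => _ [j Pj <-]; exact: lbF.
Qed.

Lemma le_inf_image (b : R) :
  P !=set0 -> (forall j, P j -> b <= F j) -> b <= inf (F @` P).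
Proof.
move=> [i Pi] lbF; apply: lb_le_inf; first by exists (F i); exists i.
by move=> _ [j Pj <-]; exact: lbF.
Qed.

Lemma inf_image_near (b e : R) : P !=set0 -> (forall j, P j -> b <= F j) ->
  0 < e -> exists2 i, P i & F i < inf (F @` P) + e.
Proof.
move=> [i Pi] lbF e0; have [] := @inf_adherent R (F @` P) e e0.
  split; first by exists (F i); exists i.
  by exists b => _ [j Pj <-]; exact: lbF.
by move=> _ [j Pj <-] ?; exists j.
Qed.

End InfimumOfFamily.

(** * Algebraic Hahn-Banach theorem for finite convex functions *)

Section HahnBanach.
Variables (R : realType) (V : lmodType R).
Implicit Types (p q : V -> R) (x y : V).

(** Homogeneity is only an inequality, which is easy to check on infima; using it at [t] and at its
    inverse gives equality. *)
Definition sublinear q : Prop :=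
  (forall x y, q (x + y) <= q x + q y) /\
  (forall t x, 0 < t -> q (t *: x) <= t * q x).

Lemma sublinear0 q : sublinear q -> q 0 = 0.
Proof.
move=> [_ qZ]; apply/eqP; rewrite eq_le; apply/andP; split.
  by have := qZ 2^-1 0 ltac:(lra); rewrite scaler0; lra.
by have := qZ 2 0 ltac:(lra); rewrite scaler0; lra.
Qed.

Lemma sublinearZ q t x : sublinear q -> 0 <= t -> q (t *: x) = t * q x.
Proof.
move=> qs; rewrite le_eqVlt => /predU1P[<-|t0].
  by rewrite scale0r mul0r sublinear0.
apply/eqP; rewrite eq_le qs.2//= -ler_pdivlMl//.
have := qs.2 t^-1 (t *: x); rewrite scalerA mulVf ?gt_eqF// scale1r.
by apply; rewrite invr_gt0.
Qed.

Lemma sublinear_geN q x : sublinear q -> - q (- x) <= q x.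
Proof. by move=> qs; have := qs.1 x (- x); rewrite subrr sublinear0//; lra. Qed.

(** Zorn's lemma for the reversed pointwise order: a chain is bounded by its pointwise infimum,
    which is finite because [q <= p] forces [- p (- x) <= q x]. *)
Lemma exists_minimal_sublinear p : sublinear p ->
  exists2 q, sublinear q /\ (forall x, q x <= p x) &
    forall q', sublinear q' -> (forall x, q' x <= q x) -> q' = q.
Proof.
move=> ps; pose T := {q : V -> R | sublinear q /\ forall x, q x <= p x}.
pose le_T (q r : T) := `[< forall x, sval r x <= sval q x >].
have p_T : sublinear p /\ forall x, p x <= p x by [].
have lbT (q : T) x : - p (- x) <= sval q x.
  case: q => q [qs qp] /=; have := sublinear_geN x qs; have := qp (- x); lra.
have := @Zorn T le_T; case.
- by move=> q; apply/asboolP.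
- move=> q r s /asboolP qr /asboolP rs; apply/asboolP => x.
  exact: le_trans (rs x) (qr x).
- move=> [q Pq] [r Pr] /asboolP/= qr /asboolP/= rq.
  apply: eq_exist; apply/funext => x; apply/eqP.
  by rewrite eq_le qr rq.
- move=> A totA; have [[q0 Aq0]|A0] := pselect (A !=set0); last first.
    by exists (exist _ p p_T) => s As; exfalso; apply: A0; exists s.
  pose m x := inf ((fun q : T => sval q x) @` A).
  have m_le (q : T) x : A q -> m x <= sval q x.
    by move=> Aq; apply: (inf_image_le (b := - p (- x))).
  have ge_m x b : (forall q : T, A q -> b <= sval q x) -> b <= m x.
    by move=> H; apply: le_inf_image => //; exists q0.
  have m_T : sublinear m /\ forall x, m x <= p x.
    split; last by move=> x; apply: le_trans (m_le _ _ Aq0) _; exact: (svalP q0).2.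
    split=> [x y|t x t0].
      rewrite -lerBlDr; apply/ge_m => q Aq.
      rewrite lerBlDr -lerBlDl; apply/ge_m => r Ar.
      rewrite lerBlDl.
      (* The smaller of the two members of the chain is used at both points. *)
      have [/asboolP qr|/asboolP rq] := totA _ _ Aq Ar.
        apply: le_trans (m_le _ _ Ar) _; apply: le_trans ((svalP r).1.1 x y) _.
        by rewrite lerD2r.
      apply: le_trans (m_le _ _ Aq) _; apply: le_trans ((svalP q).1.1 x y) _.
      by rewrite lerD2l.
    rewrite -ler_pdivrMl//; apply/ge_m => q Aq.
    rewrite ler_pdivrMl//; apply: le_trans (m_le _ _ Aq) _.
    exact: (svalP q).1.2.
  by exists (exist _ m m_T) => q Aq; apply/asboolP => x; exact: m_le.
move=> [q [qs qp]] qmin; exists q => // q' q's q'q.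
have q'p x : q' x <= p x by exact: le_trans (q'q x) (qp x).
have := qmin (exist _ q' (conj q's q'p)) => /(_ _)/(congr1 sval)/=; apply.
exact/asboolP.
Qed.

(** For fixed [y], the infimum over [t >= 0] of [q (x + t y) - t q y] is sublinear in [x] and below
    [q], hence equal to [q]; its bound at [t = 1] is the missing half of additivity. *)
Lemma minimal_sublinear_linear q : sublinear q ->
  (forall q', sublinear q' -> (forall x, q' x <= q x) -> q' = q) ->
  forall a x y, q (a *: x + y) = a * q x + q y.
Proof.
move=> qs qmin.
have qD x y : q (x + y) = q x + q y.
  pose P := [set t : R | 0 <= t].
  pose F x t := q (x + t *: y) - t * q y.
  pose m x := inf (F x @` P).
  have lbF z t : P t -> - q (- z) <= F z t.
    move=> t0; have := qs.1 (z + t *: y) (- z).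
    by rewrite addrAC subrr add0r sublinearZ// /F; lra.
  have m_le z t : 0 <= t -> m z <= F z t.
    by move=> t0; apply: (inf_image_le (b := - q (- z))) => //; exact: lbF.
  have ge_m z b : (forall t, 0 <= t -> b <= F z t) -> b <= m z.
    by move=> H; apply: le_inf_image => //; exists 0; rewrite /P /=.
  have ms : sublinear m.
    split=> [u v|t u t0].
      rewrite -lerBlDr; apply/ge_m => s s0.
      rewrite lerBlDr -lerBlDl; apply/ge_m => r r0.
      rewrite lerBlDl; apply: le_trans (m_le _ _ (addr_ge0 s0 r0)) _.
      have := qs.1 (u + s *: y) (v + r *: y).
      by rewrite addrACA -scalerDl /F; lra.
    rewrite -ler_pdivrMl//; apply/ge_m => s s0; rewrite ler_pdivrMl//.
    apply: le_trans (m_le _ _ (mulr_ge0 (ltW t0) s0)) _.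
    rewrite /F -scalerA -scalerDr; have := qs.2 t (u + s *: y) t0; lra.
  have mE : m = q.
    apply: qmin => // z; have := m_le z 0 (lexx _).
    by rewrite /F scale0r addr0 mul0r subr0.
  apply/eqP; rewrite eq_le qs.1/=.
  have := m_le x 1 ler01; rewrite mE /F scale1r; lra.
have qN x : q (- x) = - q x.
  by have := qD x (- x); rewrite subrr sublinear0//; lra.
move=> a x y; rewrite qD; congr (_ + _).
have [a0|a0] := leP 0 a; first exact: sublinearZ.
have := @sublinearZ q (- a) x qs ltac:(lra).
by rewrite scaleNr qN; lra.
Qed.

(** The directional derivative of [k] at the origin, an infimum of difference quotients, is
    sublinear, and a minimal sublinear function below it is linear. *)
Lemma linear_minorant_of_convex (k : V -> R) :
  (forall x y t, 0 < t < 1 ->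
    k (t *: x + (1 - t) *: y) <= t * k x + (1 - t) * k y) ->
  exists2 L : V -> R, (forall a x y, L (a *: x + y) = a * L x + L y) &
    forall x, k 0 + L x <= k x.
Proof.
move=> kconv; pose P := [set t : R | 0 < t].
pose F x t := t^-1 * (k (t *: x) - k 0).
pose p x := inf (F x @` P).
have lbF x t : P t -> - (k (- x) - k 0) <= F x t.
  rewrite /P/= => t0; rewrite /F ler_pdivlMl//.
  (* This [s] writes the origin as the convex combination [s (t x) + (1 - s) (- x)]. *)
  have [s s0 sE] : exists2 s : R, 0 < s & s * (1 + t) = 1.
    exists (1 + t)^-1; first by rewrite invr_gt0; lra.
    by rewrite mulVf// gt_eqF//; lra.
  have st0 : 0 < s * t by rewrite mulr_gt0.
  have s1 : 0 < s < 1 by rewrite s0/=; lra.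
  have := kconv (t *: x) (- x) _ s1.
  have E : 1 - s = s * t by lra.
  rewrite E scalerN scalerA subrr => H; rewrite -(ler_pM2l s0).
  have : s * t * k 0 = k 0 - s * k 0 by rewrite -E; ring.
  lra.
have p_le x t : 0 < t -> p x <= F x t.
  by move=> t0; apply: (inf_image_le (b := - (k (- x) - k 0))) => //; exact: lbF.
have ge_p x b : (forall t, 0 < t -> b <= F x t) -> b <= p x.
  by move=> H; apply: le_inf_image => //; exists 1; rewrite /P /= ltr01.
have ps : sublinear p.
  split=> [x y|t x t0].
    rewrite -lerBlDr; apply/ge_p => s s0.
    rewrite lerBlDr -lerBlDl; apply/ge_p => r r0.
    rewrite lerBlDl.
    have c0 : 0 < s + r by lra.
    (* This multiple of [x + y] is the convex combination of [s x] and [r y] with weights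
       [r / (s + r)] and [s / (s + r)]. *)
    have m0 : 0 < s * r / (s + r) by rewrite divr_gt0// mulr_gt0.
    apply: le_trans (p_le _ _ m0) _.
    have w1 : 0 < r / (s + r) < 1.
      by rewrite divr_gt0//= ltr_pdivrMr// mul1r; lra.
    have := kconv (s *: x) (r *: y) _ w1.
    have -> : 1 - r / (s + r) = s / (s + r) by field; rewrite gt_eqF.
    rewrite !scalerA (_ : r / (s + r) * s = s * r / (s + r)); last by ring.
    rewrite (_ : s / (s + r) * r = s * r / (s + r)); last by ring.
    rewrite -scalerDr /F => H; rewrite ler_pdivrMl//.
    have -> : s * r / (s + r) * (s^-1 * (k (s *: x) - k 0) +
                r^-1 * (k (r *: y) - k 0)) =
        r / (s + r) * k (s *: x) + s / (s + r) * k (r *: y) - k 0.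
      by field; rewrite !gt_eqF.
    lra.
  rewrite -ler_pdivrMl//; apply/ge_p => s s0; rewrite ler_pdivrMl//.
  apply: le_trans (p_le _ (s / t) (divr_gt0 s0 t0)) _.
  rewrite /F scalerA divfK ?gt_eqF//.
  by rewrite invfM invrK mulrA [t * _]mulrC.
have [q [qs qp] qmin] := exists_minimal_sublinear ps.
exists q; first exact: minimal_sublinear_linear.
move=> x; have := le_trans (qp x) (p_le x 1 ltr01).
by rewrite /F scale1r invr1 mul1r; lra.
Qed.

End HahnBanach.

(** * Continuous linear functionals and the dual norm *)

Section Dual.
Variables (R : realType) (X : completeNormedModType R).
Implicit Types (f g : X -> R) (x y : X).

Lemma in_dualB f x y : in_dual f -> f (x - y) = f x - f y.
Proof. by case=> fl _; rewrite [x - y]addrC -(scaleN1r y) fl; ring. Qed.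

Lemma in_dual_at0 f : in_dual f -> f 0 = 0.
Proof. by move=> fd; rewrite -(subrr (0 : X)) in_dualB// subrr. Qed.

Lemma in_dualZ f a x : in_dual f -> f (a *: x) = a * f x.
Proof. by move=> fd; have := fd.1 a x 0; rewrite in_dual_at0// !addr0. Qed.

Lemma in_dualN f x : in_dual f -> f (- x) = - f x.
Proof. by move=> fd; rewrite -scaleN1r in_dualZ// mulN1r. Qed.

Lemma in_dualD f x y : in_dual f -> f (x + y) = f x + f y.
Proof. by move=> fd; rewrite -{1}[y]opprK in_dualB// in_dualN// opprK. Qed.

Lemma in_dual_bounded f : in_dual f ->
  exists2 C, 0 <= C & forall x, `|f x| <= C * `|x|.
Proof.
move=> [fl fc].
pose L : {linear X -> R^o} := HB.pack f (GRing.isLinear.Build R X R^o _ f fl).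
have /linear_boundedP/pinfty_ex_gt0[r r0 fr] : bounded_near L (nbhs 0).
  by apply/linear_bounded_continuous.
by exists r => //; exact: ltW.
Qed.

Lemma bounded_in_dual f C :
  (forall a x y, f (a *: x + y) = a * f x + f y) ->
  (forall x, `|f x| <= C * `|x|) -> in_dual f.
Proof.
move=> fl fC; split=> //.
pose L : {linear X -> R^o} := HB.pack f (GRing.isLinear.Build R X R^o _ f fl).
suff : continuous L by [].
apply/linear_bounded_continuous/linear_boundedP.
near=> r => x; apply: le_trans (fC x) _; apply: ler_wpM2r => //.
Unshelve. all: by end_near. Qed.

Lemma in_dual_comb a f g :
  in_dual f -> in_dual g -> in_dual (fun x => a * f x + g x).
Proof.
move=> fd gd; have [C C0 fC] := in_dual_bounded fd.
have [D D0 gD] := in_dual_bounded gd.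
apply: (@bounded_in_dual _ (`|a| * C + D)) => [b x y|x].
  by rewrite fd.1 gd.1; ring.
apply: le_trans (ler_normD _ _) _; rewrite mulrDl lerD//.
by rewrite normrM -mulrA ler_wpM2l.
Qed.

Lemma in_dual_zero : in_dual (fun _ : X => 0).
Proof.
apply: (@bounded_in_dual _ 0) => [a x y|x]; first by rewrite mulr0 addr0.
by rewrite normr0 mul0r.
Qed.

Lemma in_dual_sub f g : in_dual f -> in_dual g -> in_dual (fun x => f x - g x).
Proof.
move=> fd gd; have := in_dual_comb (-1) gd fd.
by congr in_dual; apply/funext => x; ring.
Qed.

Lemma in_dual_add f g : in_dual f -> in_dual g -> in_dual (fun x => f x + g x).
Proof.
move=> fd gd; have := in_dual_comb 1 fd gd.
by congr in_dual; apply/funext => x; ring.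
Qed.

Lemma in_dual_scale a f : in_dual f -> in_dual (fun x => a * f x).
Proof.
move=> fd; have := in_dual_comb a fd in_dual_zero.
by congr in_dual; apply/funext => x; rewrite addr0.
Qed.

Lemma dnorm_le f C :
  (forall x, `|x| <= 1 -> `|f x| <= C) -> dnorm f <= C.
Proof.
move=> fC; apply: ge_sup.
  by exists `|f 0|; exists 0 => //=; rewrite normr0.
by move=> _ [x x1 <-]; exact: fC.
Qed.

Lemma le_dnorm f x : in_dual f -> `|x| <= 1 -> `|f x| <= dnorm f.
Proof.
move=> fd x1; have [C C0 fC] := in_dual_bounded fd.
apply: ub_le_sup; last by exists x.
exists C => _ [y y1 <-]; apply: le_trans (fC y) _.
by rewrite -[leRHS]mulr1 ler_wpM2l.
Qed.

Lemma dnorm_ge0 f : in_dual f -> 0 <= dnorm f.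
Proof.
move=> fd; apply: le_trans (le_dnorm (x := 0) fd _); first exact: normr_ge0.
by rewrite normr0.
Qed.

Lemma norm_le_dnorm f x : in_dual f -> `|f x| <= dnorm f * `|x|.
Proof.
move=> fd; have [->|x0] := eqVneq x 0.
  by rewrite in_dual_at0// !normr0 mulr0.
have nx : 0 < `|x| by rewrite normr_gt0.
rewrite -ler_pdivrMr// mulrC.
have := @le_dnorm f (`|x|^-1 *: x) fd.
rewrite normrZ normfV normr_id mulVf ?gt_eqF// lexx => /(_ isT).
by rewrite in_dualZ// normrM normfV normr_id.
Qed.

Lemma dnorm_le_of_bound f C : 0 <= C ->
  (forall x, `|f x| <= C * `|x|) -> dnorm f <= C.
Proof.
move=> C0 fC; apply: dnorm_le => x x1; apply: le_trans (fC x) _.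
by rewrite -[leRHS]mulr1 ler_wpM2l.
Qed.

Lemma dnormD_le f g : in_dual f -> in_dual g ->
  dnorm (fun x => f x + g x) <= dnorm f + dnorm g.
Proof.
move=> fd gd; apply: dnorm_le => x x1.
by apply: le_trans (ler_normD _ _) _; rewrite lerD// le_dnorm.
Qed.

Lemma dnormB_le f g h : in_dual f -> in_dual g -> in_dual h ->
  dnorm (fun x => f x - h x) <=
  dnorm (fun x => f x - g x) + dnorm (fun x => g x - h x).
Proof.
move=> fd gd hd.
have := dnormD_le (in_dual_sub fd gd) (in_dual_sub gd hd).
by congr (dnorm _ <= _); apply/funext => x; ring.
Qed.

Lemma dnorm_distC f g : dnorm (fun x => f x - g x) = dnorm (fun x => g x - f x).
Proof.
rewrite /dnorm; congr sup; apply/seteqP; split=> _ [x x1 <-]; exists x => //;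
  exact: distrC.
Qed.

Lemma dnormZ_le a f : in_dual f -> dnorm (fun x => a * f x) <= `|a| * dnorm f.
Proof.
move=> fd; apply: dnorm_le => x x1.
by rewrite normrM ler_wpM2l// le_dnorm.
Qed.

Lemma dnorm_zero : dnorm (fun _ : X => 0 : R) = 0.
Proof.
apply/eqP; rewrite eq_le dnorm_ge0 ?andbT; last exact: in_dual_zero.
by apply: dnorm_le => x _; rewrite normr0.
Qed.

Lemma pairing_continuous (p : X * (X -> R)) (e : R) : in_dual p.2 -> 0 < e ->
  exists2 d, 0 < d & forall q : X * (X -> R), in_dual q.2 ->
    `|q.1 - p.1| < d -> dnorm (fun x => q.2 x - p.2 x) < d ->
    `|q.2 q.1 - p.2 p.1| < e.
Proof.
case: p => x f /= fd e0; have n0 := dnorm_ge0 fd; have nx := normr_ge0 x.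
(* Distances below 1 absorb the product of the two errors into a linear term; the factor 2 shares
   [e] between the error in the point and that in the functional. *)
pose K := 2 * (`|x| + dnorm f + 1).
have K1 : 1 <= K by rewrite /K; lra.
exists (Num.min 1 (e / K)).
  by rewrite lt_min ltr01/= divr_gt0//; lra.
move=> [y g] /= gd; rewrite !lt_min => /andP[y1 yK] /andP[g1 gK].
have {gK} gK : dnorm (fun x => g x - f x) * K < e.
  by rewrite -ltr_pdivlMr//; lra.
have {yK} yK : `|y - x| * K < e by rewrite -ltr_pdivlMr//; lra.
have gfd := in_dual_sub gd fd.
have -> : g y - f x = (g (y - x) - f (y - x)) + (g x - f x) + f (y - x).
  by rewrite !in_dualB//; ring.
apply: le_lt_trans (ler_normD _ _) _.
apply: le_lt_trans (lerD (ler_normD _ _) (lexx _)) _.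
have H1 := norm_le_dnorm (y - x) gfd; have H2 := norm_le_dnorm x gfd.
have H3 := norm_le_dnorm (y - x) fd.
apply: le_lt_trans (lerD (lerD H1 H2) H3) _.
have a0 := dnorm_ge0 gfd; have b0 := normr_ge0 (y - x).
have := ler_wpM2r b0 (ltW g1); have := mulr_ge0 a0 n0; have := mulr_ge0 b0 nx.
by move: gK yK; rewrite /K; lra.
Qed.

End Dual.

(** * The dual as a module *)

Section DualSpace.
Variables (R : realType) (X : completeNormedModType R).

Definition dual_pred : {pred X -> R^o} := fun f => `[< in_dual (f : X -> R) >].

Lemma dual_pred_submod_closed : submod_closed dual_pred.
Proof.
split=> [|a f g]; first exact/asboolP/in_dual_zero.
by move=> /asboolP fd /asboolP gd; apply/asboolP; exact: in_dual_comb.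
Qed.

HB.instance Definition _ := GRing.isSubmodClosed.Build R (X -> R^o) dual_pred
  dual_pred_submod_closed.

(** Bundling makes [X * dual X] a module, to which the Hahn-Banach lemma applies. *)
Record dual : Type := Dual { dual_fun :> X -> R^o; _ : dual_fun \in dual_pred }.

HB.instance Definition _ := [isSub for dual_fun].
HB.instance Definition _ := [Choice of dual by <:].
HB.instance Definition _ := [SubChoice_isSubLmodule of dual by <:].

Lemma dualP (f : dual) : in_dual (f : X -> R).
Proof. by case: f => f /= /asboolP. Qed.

(** The value 0 is a dummy default: elements of the bidual are tested on continuous functionals
    only. *)
Definition to_dual (f : X -> R) : dual :=
  if pselect (in_dual f) is left fd then Dual (asboolT fd) else 0.

Lemma to_dualK (f : X -> R) : in_dual f -> to_dual f = f :> (X -> R).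
Proof. by rewrite /to_dual; case: pselect. Qed.

Lemma dual_inj (f g : dual) : (f : X -> R) = g -> f = g.
Proof. exact: val_inj. Qed.

End DualSpace.

(** * Condition (NI), translations and Fitzpatrick functions *)

Section NegativeInfimum.
Variables (R : realType) (X : completeNormedModType R).
Implicit Types T : operator X.

(* Simons' condition (NI), the only consequence of type (D) that is needed. *)
Definition type_NI T : Prop :=
  forall phi (f : X -> R), in_bidual phi -> in_dual f -> forall e, 0 < e ->
    exists2 q, T q & phi (fun x => f x - q.2 x) - (f q.1 - q.2 q.1) < e.

(** If the bound fails at [e], then [(phi, f)] lies in [Ttilde T]. Along the net of type (D), the
    quantity to be bounded is at most a constant times the dual norm of [f - q.2], which tends to
    0. *)
Lemma type_D_NI T : type_D T -> type_NI T.
Proof.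
move=> [[Tg [Tm Tmax]] TD] phi f phid fd e e0; apply: contrapT => H.
have Ht : Ttilde T (phi, f).
  split=> //; split=> // q Tq; rewrite leNgt; apply/negP => /= lt0; apply: H.
  by exists q => //; exact: lt_trans e0.
have [I [le [net [[[i0] [lexx' _]] [netT [[M Mb] [_ cvf]]]]]]] := TD _ Ht.
have [_ [C phiC]] := phid.
have K1 : 0 < `|C| + `|M| + 1 by rewrite addrC ltr_pwDl// addr_ge0.
have [i /(_ _ (lexx' i))] := cvf _ (divr_gt0 e0 K1).
rewrite subr0 /= (dnorm_distC (net i).2 f); have qd := Tg _ (netT i).
have fqd := in_dual_sub fd qd.
rewrite ger0_norm ?dnorm_ge0// ltr_pdivlMr// => lte.
apply: H; exists (net i) => //.
apply: le_lt_trans lte.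
have H1 := le_trans (ler_norm _) (phiC _ fqd).
have H2 := norm_le_dnorm (net i).1 fqd.
have H3 := le_trans (Mb i).1 (ler_norm M).
have n0 := dnorm_ge0 fqd.
have H4 := ler_wpM2r n0 (ler_norm C).
have H5 := ler_wpM2l n0 H3.
have H6 := ler_norm (- (f (net i).1 - (net i).2 (net i).1)).
rewrite normrN in H6.
move: (phi _) H1 => ph H1.
rewrite mulrDr mulrDr mulr1; lra.
Qed.

Definition shift_op T (c : X * (X -> R)) : operator X :=
  [set (q.1 - c.1, fun x => q.2 x - c.2 x) | q in T].

Lemma graph_in_XXs_shift T c :
  in_dual c.2 -> graph_in_XXs T -> graph_in_XXs (shift_op T c).
Proof. by move=> cd Tg _ [q Tq <-] /=; apply: in_dual_sub => //; exact: Tg. Qed.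

Lemma monotone_shift T c : monotone T -> monotone (shift_op T c).
Proof.
move=> Tm _ _ [q Tq <-] [r Tr <-] /=.
rewrite (_ : q.1 - c.1 - (r.1 - c.1) = q.1 - r.1); last first.
  by rewrite opprB addrA subrK.
by have := Tm _ _ Tq Tr; lra.
Qed.

(** Testing the translate at [(phi, f)] amounts to testing [T] at [(phi + a, f + b)], where [a] acts
    on the dual by evaluation. *)
Lemma type_NI_shift T c :
  in_dual c.2 -> graph_in_XXs T -> type_NI T -> type_NI (shift_op T c).
Proof.
case: c => a b /= bd Tg TNI phi f [phil [C phiC]] fd e e0.
have phid : in_bidual (fun g => phi g + g a).
  split=> [t g h gd hd|]; first by rewrite phil//; ring.
  exists (C + `|a|) => g gd; apply: le_trans (ler_normD _ _) _.
  by rewrite mulrDl lerD// ?phiC// mulrC norm_le_dnorm.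
have [[y g] Tq /=] := TNI _ _ phid (in_dual_add fd bd) _ e0.
have gd : in_dual g := Tg _ Tq.
move=> H; exists (y - a, fun x => g x - b x); first by exists (y, g).
move: H; rewrite /= (_ : (fun x => f x + b x - g x) =
  (fun x => f x - (g x - b x))); last by apply/funext => x; ring.
rewrite (in_dualB y a fd) (in_dualB y a gd) (in_dualB y a bd).
by move: (phi _) => m; lra.
Qed.

(** This is the canonical embedding of [X] into its bidual. *)
Lemma in_bidual_eval (x : X) : in_bidual (fun f : X -> R => f x).
Proof.
split=> //; exists `|x| => f fd; rewrite mulrC; exact: norm_le_dnorm.
Qed.

(* [fitzpatrick_le T p r] says that the Fitzpatrick function of [T] is at most
   [r] at [p]; this avoids a supremum that may be infinite. *)
Definition fitzpatrick_le T (p : X * (X -> R)) (r : R) : Prop :=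
  forall q, T q -> q.2 p.1 + p.2 q.1 - q.2 q.1 <= r.

Lemma fitzpatrick_le_graph T p : graph_in_XXs T -> monotone T -> T p ->
  fitzpatrick_le T p (p.2 p.1).
Proof.
move=> Tg Tm Tp q Tq; have := Tm _ _ Tp Tq.
by rewrite (in_dualB _ _ (Tg _ Tp)) (in_dualB _ _ (Tg _ Tq)); lra.
Qed.

(** Condition (NI) at the canonical image of [p.1] gives points of [T] whose terms in the
    Fitzpatrick supremum exceed the pairing minus [e]. *)
Lemma fitzpatrick_le_pairing T p r : graph_in_XXs T -> type_NI T ->
  in_dual p.2 -> fitzpatrick_le T p r -> p.2 p.1 <= r.
Proof.
move=> Tg TNI pd Fp; apply/ler_addgt0Pr => e e0.
have [q Tq] := TNI _ _ (in_bidual_eval p.1) pd _ e0.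
by have := Fp _ Tq; lra.
Qed.

Lemma fitzpatrick_le_convex T p q r s t : graph_in_XXs T -> 0 < t < 1 ->
  fitzpatrick_le T p r -> fitzpatrick_le T q s ->
  fitzpatrick_le T
    (t *: p.1 + (1 - t) *: q.1, fun x => t * p.2 x + (1 - t) * q.2 x)
    (t * r + (1 - t) * s).
Proof.
move=> Tg /andP[t0 t1] Fp Fq z Tz /=; have zd := Tg _ Tz.
rewrite zd.1 in_dualZ//.
have := ler_wpM2l (ltW t0) (Fp _ Tz).
have := ler_wpM2l (_ : 0 <= 1 - t) (Fq _ Tz).
by move=> /(_ ltac:(lra)); lra.
Qed.

End NegativeInfimum.

(** * Approximate minimizers of the Fitzpatrick function plus half the squared norm *)

Section ApproximateMinimizer.
Variables (R : realType) (X : completeNormedModType R).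
Local Notation V := (X * dual X)%type.

Definition pnorm (v : V) : R := `|v.1| + dnorm v.2.

Definition half_sq_norm (v : V) : R := (`|v.1| ^+ 2 + dnorm v.2 ^+ 2) / 2.

Lemma pnorm_ge0 v : 0 <= pnorm v.
Proof. by rewrite addr_ge0// dnorm_ge0//; exact: dualP. Qed.

Lemma pnormZ_le a v : pnorm (a *: v) <= `|a| * pnorm v.
Proof. by rewrite /pnorm mulrDr lerD ?normrZ// dnormZ_le//; exact: dualP. Qed.

Lemma half_sq_norm_le1 v : pnorm v <= 1 -> half_sq_norm v <= 1.
Proof.
have := normr_ge0 v.1; have := dnorm_ge0 (dualP v.2).
by rewrite /pnorm /half_sq_norm; nra.
Qed.

Lemma sqr_convex_le (a b c t : R) : 0 <= a -> 0 < t < 1 ->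
  a <= t * b + (1 - t) * c -> a ^+ 2 <= t * b ^+ 2 + (1 - t) * c ^+ 2.
Proof.
move=> a0 /andP[t0 t1] H.
apply: le_trans (lerXn2r 2 _ _ H) _; rewrite ?nnegrE//; first exact: le_trans H.
(* This is the convexity defect of the square at [b] and [c]. *)
have : 0 <= t * (1 - t) * (b - c) ^+ 2.
  by rewrite mulr_ge0 ?sqr_ge0// mulr_ge0//; lra.
by lra.
Qed.

Lemma half_sq_norm_convex t v w : 0 < t < 1 ->
  half_sq_norm (t *: v + (1 - t) *: w) <=
  t * half_sq_norm v + (1 - t) * half_sq_norm w.
Proof.
move=> t01; have /andP[t0 t1] := t01.
have H1 : `|(t *: v + (1 - t) *: w).1| ^+ 2 <=
    t * `|v.1| ^+ 2 + (1 - t) * `|w.1| ^+ 2.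
  apply: sqr_convex_le => //=; apply: le_trans (ler_normD _ _) _.
  by rewrite !normrZ !ger0_norm//; lra.
have H2 : dnorm (t *: v + (1 - t) *: w).2 ^+ 2 <=
    t * dnorm v.2 ^+ 2 + (1 - t) * dnorm w.2 ^+ 2.
  apply: sqr_convex_le => //; first exact: dnorm_ge0 (dualP _).
  apply: le_trans (dnormD_le (dualP (t *: v.2)) (dualP ((1 - t) *: w.2))) _.
  have := dnormZ_le t (dualP v.2); have := dnormZ_le (1 - t) (dualP w.2).
  rewrite !ger0_norm//; first (by move=> ? ?; apply: lerD); lra.
by rewrite /half_sq_norm; lra.
Qed.

Lemma le_of_le_unit (L : V -> R) (M : R) :
  (forall a v w, L (a *: v + w) = a * L v + L w) ->
  (forall v, pnorm v <= 1 -> L v <= M) -> forall v, L v <= M * pnorm v.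
Proof.
move=> Ll LM v.
have L0 : L 0 = 0 by have := Ll 1 0 0; rewrite scale1r addr0; lra.
have LZ a w : L (a *: w) = a * L w by have := Ll a w 0; rewrite L0 !addr0.
have pnorm0 : pnorm 0 <= 1.
  by have := pnormZ_le 0 0; rewrite scale0r normr0 mul0r; lra.
have M0 : 0 <= M by rewrite -L0; exact: LM.
apply/ler_addgt0Pr => e e0.
(* Adding this term to the divisor [pnorm v] covers [pnorm v = 0], at a cost of
   [M e / (M + 1) <= e]. *)
have d0 : 0 < e / (M + 1) by rewrite divr_gt0//; lra.
have nd : 0 < pnorm v + e / (M + 1) by have := pnorm_ge0 v; lra.
have := LM ((pnorm v + e / (M + 1))^-1 *: v).
have -> : pnorm ((pnorm v + e / (M + 1))^-1 *: v) <= 1.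
  apply: le_trans (pnormZ_le _ _) _.
  rewrite ger0_norm ?invr_ge0 ?(ltW nd)// mulrC ler_pdivrMr// mul1r; lra.
move=> /(_ isT); rewrite LZ ler_pdivrMl// => H; apply: le_trans H _.
rewrite mulrC mulrDr lerD2l mulrCA -[leRHS]mulr1 ler_wpM2l ?(ltW e0)//.
by rewrite ler_pdivrMr; lra.
Qed.

(* The infimal convolution of the Fitzpatrick function with half the squared
   norm is a finite convex function, which the linear minorant [L] supports at
   the origin. *)
Lemma fitzpatrick_half_sq_norm_small (T : operator X) (eta : R) :
  graph_in_XXs T -> monotone T -> type_NI T -> 0 < eta ->
  exists (v : V) (r : R),
    fitzpatrick_le T (v.1, v.2 : X -> R) r /\ r + half_sq_norm v < eta.
Proof.
move=> Tg Tm TNI eta0; apply: contrapT => noV.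
pose P := [set i : V * R | fitzpatrick_le T (i.1.1, i.1.2 : X -> R) i.2].
have Pge i : P i -> eta <= i.2 + half_sq_norm i.1.
  move=> Pi; rewrite leNgt; apply/negP => lt_eta.
  by apply: noV; exists i.1, i.2.
have Pconv i j t : P i -> P j -> 0 < t < 1 ->
    P (t *: i.1 + (1 - t) *: j.1, t * i.2 + (1 - t) * j.2).
  by move=> Pi Pj t01; exact: (fitzpatrick_le_convex Tg t01 Pi Pj).
have PT q : T q -> P ((q.1, to_dual q.2), q.2 q.1).
  move=> Tq; have qd := Tg _ Tq; rewrite /P /= to_dualK//.
  by case: q Tq qd => y g Tq _; exact: fitzpatrick_le_graph.
have [q0 Tq0] : T !=set0.
  have [q Tq _] := TNI _ _ (in_bidual_eval 0) (in_dual_zero X) _ ltr01.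
  by exists q.
have [i0 Pi0] : P !=set0 by eexists; exact: PT Tq0.
pose F (w : V) (i : V * R) := i.2 + half_sq_norm (i.1 - w).
(* The midpoint of [i] and [i0] is also that of [i - w] and [i0 + w]; convexity turns the bound
   [eta] there into one independent of [i]. *)
have lbF w i : P i -> 2 * eta - i0.2 - half_sq_norm (i0.1 + w) <= F w i.
  move=> Pi; have t01 : 0 < (2^-1 : R) < 1 by apply/andP; split; lra.
  have := Pge _ (Pconv _ _ _ Pi Pi0 t01); rewrite /=.
  have -> : 2^-1 *: i.1 + (1 - 2^-1) *: i0.1 =
            2^-1 *: (i.1 - w) + (1 - 2^-1) *: (i0.1 + w).
    rewrite (_ : 1 - 2^-1 = 2^-1 :> R); last by lra.
    by rewrite -!scalerDr addrACA [- w + w]addrC subrr addr0.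
  have := half_sq_norm_convex (i.1 - w) (i0.1 + w) t01.
  by rewrite /F; lra.
pose k w := inf (F w @` P).
have k_le w i : P i -> k w <= F w i.
  by move=> Pi; apply: inf_image_le (lbF w) Pi.
have kconv v w t : 0 < t < 1 ->
    k (t *: v + (1 - t) *: w) <= t * k v + (1 - t) * k w.
  move=> t01; have /andP[t0 t1] := t01; apply/ler_addgt0Pr => e e0.
  have P0 : P !=set0 by exists i0.
  have [i Pi Hi] := inf_image_near P0 (lbF v) e0.
  have [j Pj Hj] := inf_image_near P0 (lbF w) e0.
  apply: le_trans (k_le _ _ (Pconv _ _ _ Pi Pj t01)) _; rewrite /F /=.
  have -> : t *: i.1 + (1 - t) *: j.1 - (t *: v + (1 - t) *: w) =
            t *: (i.1 - v) + (1 - t) *: (j.1 - w).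
    by rewrite !scalerBr opprD addrACA.
  have := half_sq_norm_convex (i.1 - v) (j.1 - w) t01.
  have := ler_wpM2l (ltW t0) (ltW Hi).
  have := ler_wpM2l (_ : 0 <= 1 - t) (ltW Hj).
  by move=> /(_ ltac:(lra)); rewrite /F -!/(k _); lra.
have k0 : eta <= k 0.
  apply: le_inf_image; first by exists i0.
  by move=> i Pi; rewrite /F subr0; exact: Pge.
have [L Ll Lk] := linear_minorant_of_convex kconv.
have L0 : L 0 = 0 by have := Ll 1 0 0; rewrite scale1r addr0; lra.
have LZ a w : L (a *: w) = a * L w by have := Ll a w 0; rewrite L0 !addr0.
have LD v w : L (v + w) = L v + L w by have := Ll 1 v w; rewrite scale1r mul1r.
have LN w : L (- w) = - L w by rewrite -scaleN1r LZ mulN1r.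
(* The minorant is evaluated at [i.1 - u], where [i] is a candidate for the infimum [k]. *)
have key i u : P i -> eta + L i.1 <= i.2 + L u + half_sq_norm u.
  move=> Pi; have := le_trans (Lk (i.1 - u)) (k_le _ _ Pi).
  by rewrite /F subKr LD LN; lra.
(* [key] at [i0] and [- u] bounds [L] on the unit ball by this number, so [L] is continuous. *)
pose M := i0.2 - L i0.1 - eta + 1.
have LM v : L v <= M * pnorm v.
  apply: le_of_le_unit => // u u1; have Nu1 : pnorm (- u) <= 1.
    by have := pnormZ_le (-1) u; rewrite scaleN1r normrN1; lra.
  have := key _ (- u) Pi0; have := half_sq_norm_le1 Nu1.
  by rewrite LN /M; lra.
have LM' v : `|L v| <= M * pnorm v.
  rewrite ler_norml LM andbT; have := LM (- v); rewrite LN.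
  have := pnormZ_le (-1) v; rewrite scaleN1r normrN1 mul1r.
  have := pnormZ_le (-1) (- v); rewrite scaleN1r opprK normrN1 mul1r => h1 h2.
  by have -> : pnorm (- v) = pnorm v; lra.
(* [L] splits over the product into a functional on [X] and one on the dual. *)
pose x0s x := L (x, 0).
pose phi (f : X -> R) := L (0, to_dual f).
have x0sd : in_dual x0s.
  apply: (@bounded_in_dual _ _ _ M) => [a x y|x].
    by rewrite -Ll; congr L; congr pair; rewrite /= scaler0 addr0.
  by have := LM' (x, 0); rewrite /pnorm /= dnorm_zero addr0.
have phid : in_bidual phi.
  split=> [a f g fd gd|].
    rewrite -Ll; congr L; congr pair; first by rewrite /= scaler0 addr0.
    apply: dual_inj; rewrite to_dualK; last exact: in_dual_comb.
    apply/funext => x.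
    have -> : (a *: (0, to_dual f) + (0, to_dual g) : V).2 x =
      a * to_dual f x + to_dual g x by [].
    by rewrite !to_dualK.
  exists M => f fd; have := LM' (0, to_dual f).
  by rewrite /pnorm /= to_dualK// normr0 add0r.
have phiB f g : in_dual f -> in_dual g ->
    phi (fun x => f x - g x) = phi f - phi g.
  move=> fd gd; have := phid.1 (-1) g f gd fd.
  by rewrite (_ : (fun x => -1 * g x + f x) = (fun x => f x - g x));
    [lra | apply/funext => x; ring].
have LE x f : L (x, to_dual f) = x0s x + phi f.
  by rewrite -LD; congr L; congr pair; rewrite /= ?addr0 ?add0r.
(* The functional [L] is the point [(x0s, phi)] of [X^* x X^**]. At the second
   component [x0s], the term [phi x0s] coming from (NI) cancels. *)
have H x : eta <= x0s x + (`|x| ^+ 2 + dnorm x0s ^+ 2) / 2.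
  apply/ler_addgt0Pr => e e0.
  have [q Tq] := TNI _ _ phid x0sd _ e0; have qd := Tg _ Tq.
  rewrite phiB//.
  have := key _ (x, to_dual x0s) (PT _ Tq).
  by rewrite /= !LE /half_sq_norm /= to_dualK//; lra.
set a := dnorm x0s in H; have a0 : 0 <= a := dnorm_ge0 x0sd.
(* This is [H] at [a y] and [- a y]. The supremum over the unit ball then reads
   [a ^ 2 <= a ^ 2 - eta], which is absurd. *)
have Ha y : `|y| <= 1 -> a * `|x0s y| <= a ^+ 2 - eta.
  move=> y1; have ny := normr_ge0 y.
  have ay : `|a *: y| ^+ 2 <= a ^+ 2.
    by rewrite normrZ (ger0_norm a0) exprMn ler_piMr ?sqr_ge0// expr_le1.
  have := H (- (a *: y)); have := H (a *: y).
  rewrite normrN (in_dualN _ x0sd) (in_dualZ _ _ x0sd).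
  by case: (ger0P (x0s y)) => _; lra.
have [a_0|a_0] := eqVneq a 0.
  by have := Ha 0; rewrite normr0 a_0 expr2 !mul0r ler01 => /(_ isT); lra.
have apos : 0 < a by rewrite lt_neqAle eq_sym a_0.
have : a <= a^-1 * (a ^+ 2 - eta).
  by apply: dnorm_le => y y1; rewrite ler_pdivlMl//; exact: Ha.
by rewrite ler_pdivlMl//; lra.
Qed.

End ApproximateMinimizer.

(** * Sequences with geometrically decreasing steps *)

Section GeometricSequences.
Variable R : realType.

Lemma geometric_half_lt (C e : R) : 0 < e -> exists k, C * 2^-1 ^+ k < e.
Proof.
move=> e0; have h : `|2^-1 : R| < 1 by rewrite ger0_norm; lra.
have /cvgrPdist_lt/(_ _ e0) H := cvg_geometric C h.
near \oo => k; exists k.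
have : `|0 - geometric C 2^-1 k| < e by near: k.
by rewrite sub0r normrN /geometric/=; apply: le_lt_trans; exact: ler_norm.
Unshelve. all: by end_near. Qed.

Lemma le0_of_geometric (z C : R) : (forall k, z <= C * 2^-1 ^+ k) -> z <= 0.
Proof.
move=> H; apply/ler_addgt0Pr => e e0; have [k Hk] := geometric_half_lt C e0.
by rewrite add0r; apply: le_trans (H k) (ltW Hk).
Qed.

Lemma geometric_step_cvg (W : completeNormedModType R) (u : nat -> W) (C : R) :
  0 <= C -> (forall k, `|u k.+1 - u k| <= C * 2^-1 ^+ k) ->
  exists l, forall k, `|l - u k| <= 2 * C * 2^-1 ^+ k.
Proof.
move=> C0 Hu.
have half0 k : 0 <= (2^-1 : R) ^+ k by rewrite exprn_ge0// invr_ge0.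
(* The exact partial sum of the steps is kept, so that the induction telescopes. *)
have dist k m : `|u (m + k)%N - u k| <= 2 * C * 2^-1 ^+ k - 2 * C * 2^-1 ^+ (m + k).
  elim: m => [|m IH]; first by rewrite add0n !subrr normr0.
  rewrite addSn (_ : u _ - _ = (u (m + k).+1 - u (m + k)%N) + (u (m + k)%N - u k)).
    apply: le_trans (ler_normD _ _) _; apply: le_trans (lerD (Hu _) IH) _.
    by rewrite exprS; have := half0 (m + k)%N; lra.
  by rewrite addrA subrK.
have dist' k m : (k <= m)%N -> `|u m - u k| <= 2 * C * 2^-1 ^+ k.
  move=> /subnK <-; apply: le_trans (dist _ _) _.
  by have := mulr_ge0 C0 (half0 (m - k + k)%N); lra.
have cu : cvg (u @ \oo).
  apply: cauchy_cvg; apply: cauchy_exP => e e0.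
  have [k Hk] := geometric_half_lt (2 * C) e0.
  exists (u k); exists k => // m /= km.
  rewrite -ball_normE /ball_ /= distrC; exact: le_lt_trans (dist' _ _ km) Hk.
exists (lim (u @ \oo)) => k.
have cn : (fun m => `|u m - u k|) @ \oo --> `|lim (u @ \oo) - u k|.
  by apply: cvg_norm; apply: cvgB => //; exact: cvg_cst.
apply: (cvgr_to_le cn).
by exists k => // m /= km; exact: dist'.
Qed.

End GeometricSequences.

Lemma sqr_add_le (R : realType) (x y t : R) : 0 <= x -> 0 <= t ->
  x ^+ 2 + y ^+ 2 <= t ^+ 2 -> x <= t.
Proof.
by move=> x0 t0 H; rewrite -ler_sqr ?nnegrE//; have := sqr_ge0 y; lra.
Qed.

(** * The Brondsted-Rockafellar property under condition (NI) *)

Section BrondstedRockafellar.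
Variables (R : realType) (X : completeNormedModType R).
Implicit Types (T : operator X) (p c : X * (X -> R)).

(** The Fitzpatrick function is a supremum of continuous affine functions, so the limit is taken for
    each [q] separately. *)
Lemma fitzpatrick_le_closed T p r : graph_in_XXs T -> in_dual p.2 ->
  (forall e, 0 < e -> exists c,
    [/\ in_dual c.2, `|c.1 - p.1| < e, dnorm (fun x => c.2 x - p.2 x) < e &
        fitzpatrick_le T c (r + e)]) ->
  fitzpatrick_le T p r.
Proof.
move=> Tg pd H q Tq; have qd := Tg _ Tq; apply/ler_addgt0Pr => e e0.
have n0 := dnorm_ge0 qd; have m0 := normr_ge0 q.1.
have K0 : 0 < dnorm q.2 + `|q.1| + 1 by lra.
have [c [cd c1 c2 Fc]] := H _ (divr_gt0 e0 K0).
have := Fc _ Tq; move: c1 c2.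
set d := e / _ => c1 c2 H0.
have dE : d * (dnorm q.2 + `|q.1| + 1) = e by rewrite divfK// gt_eqF.
have H1 := norm_le_dnorm (c.1 - p.1) qd.
have H2 := norm_le_dnorm q.1 (in_dual_sub cd pd).
have H3 := ler_wpM2l n0 (ltW c1).
have H4 := ler_wpM2r m0 (ltW c2).
rewrite (in_dualB _ _ qd) in H1.
move: H1 H2; rewrite !ler_norml => /andP[H1 _] /andP[H2 _].
by move: H0 H1 H2 H3 H4 dE; lra.
Qed.

(** Such a point is monotonically related to all of [T], so adjoining it preserves monotonicity. *)
Lemma maximal_monotone_mem T p : maximal_monotone T -> in_dual p.2 ->
  fitzpatrick_le T p (p.2 p.1) -> T p.
Proof.
move=> [Tg [Tm Tmax]] pd Fp.
have pq q : T q -> 0 <= p.2 (p.1 - q.1) - q.2 (p.1 - q.1).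
  move=> Tq; have := Fp _ Tq.
  by rewrite (in_dualB _ _ pd) (in_dualB _ _ (Tg _ Tq)); lra.
have <- : [set q | T q \/ q = p] = T; last by right.
apply: Tmax => [q [Tq|->] //|q s|q Tq]; [exact: Tg| |by left].
move=> [Tq|->] [Ts|->].
- exact: Tm.
- have := pq _ Tq; rewrite !(in_dualB _ _ pd) !(in_dualB _ _ (Tg _ Tq)); lra.
- exact: pq.
- by rewrite subrr.
Qed.

(** With [c] translated to the origin, an approximate minimizer [(x, f)] of value bound [r] gives
    the new point. Its gap is at most [r - f x], and [- f x] is at most half the sum of the squared
    norms. *)
Lemma fitzpatrick_le_near T c (e eta : R) :
  graph_in_XXs T -> monotone T -> type_NI T -> in_dual c.2 -> 0 < eta ->
  fitzpatrick_le T c (c.2 c.1 + e) ->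
  exists c', [/\ in_dual c'.2, fitzpatrick_le T c' (c'.2 c'.1 + eta) &
    `|c'.1 - c.1| ^+ 2 + dnorm (fun x => c'.2 x - c.2 x) ^+ 2 <= 4 * (e + eta)].
Proof.
move=> Tg Tm TNI cd eta0 Fc.
have Sg := graph_in_XXs_shift cd Tg.
have SNI := type_NI_shift cd Tg TNI.
have [[x f] [r []]] := fitzpatrick_half_sq_norm_small Sg
  (monotone_shift (c := c) Tm) SNI eta0.
have fd := dualP f; rewrite /half_sq_norm /=.
move: fd; move: (dual_fun f : X -> R) => {}f fd Fr rlt.
have S0 : fitzpatrick_le (shift_op T c) (0, fun=> 0) e.
  move=> _ [q Tq <-] /=; have qd := Tg _ Tq; have := Fc _ Tq.
  rewrite (in_dual_at0 qd) (in_dual_at0 cd) (in_dualB _ _ qd) (in_dualB _ _ cd).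
  lra.
have half01 : 0 < (2^-1 : R) < 1 by apply/andP; split; lra.
(* At the midpoint of [(x, f)] and the origin, being above the pairing means
   [f x / 4 <= (r + e) / 2]. This bounds [r] from below, hence the norms from above. *)
have Fm := fitzpatrick_le_convex Sg half01 Fr S0.
have md : in_dual (fun y => 2^-1 * f y + (1 - 2^-1) * 0).
  exact: in_dual_comb fd (in_dual_scale _ (in_dual_zero X)).
have /(_ md) := fun md' => fitzpatrick_le_pairing Sg SNI md' Fm.
rewrite /= scaler0 addr0 (in_dualZ _ _ fd) => rge.
have := norm_le_dnorm x fd; rewrite ler_norml => /andP[fx _].
have := sqr_ge0 (`|x| - dnorm f) => sq.
exists (x + c.1, fun y => f y + c.2 y); split => /=.
- exact: in_dual_add.
- move=> q Tq; have qd := Tg _ Tq; have := Fr _ (ex_intro2 _ _ _ Tq erefl).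
  rewrite /= !(in_dualB _ _ qd) !(in_dualB _ _ cd) !(in_dualB _ _ fd).
  by rewrite !(in_dualD _ _ qd) !(in_dualD _ _ cd) !(in_dualD _ _ fd); lra.
- rewrite addrK (_ : (fun y => f y + c.2 y - c.2 y) = f); last first.
    by apply/funext => y; ring.
  by lra.
Qed.

(** Recentring repeatedly divides the gap by 4; the steps, of length at most [3 d / 2 ^ k], sum to
    [6 d], and the limit has gap zero. *)
Lemma fitzpatrick_graph_dist T c (d : R) :
  maximal_monotone T -> type_NI T -> in_dual c.2 -> 0 < d ->
  fitzpatrick_le T c (c.2 c.1 + d ^+ 2) ->
  exists2 q, T q &
    `|q.1 - c.1| <= 6 * d /\ dnorm (fun x => q.2 x - c.2 x) <= 6 * d.
Proof.
move=> Tmm TNI cd d0 Fc; have [Tg [Tm _]] := Tmm.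
pose P k p := in_dual p.2 /\
  fitzpatrick_le T p (p.2 p.1 + (d * 2^-1 ^+ k) ^+ 2).
pose near k p p' := `|p'.1 - p.1| <= 3 * d * 2^-1 ^+ k /\
  dnorm (fun x => p'.2 x - p.2 x) <= 3 * d * 2^-1 ^+ k.
have half0 k : 0 < (2^-1 : R) ^+ k by rewrite exprn_gt0// invr_gt0.
(* An implication, so that choice yields a total function; outside [P] the point stays put. *)
have step (kp : nat * (X * (X -> R))) : exists p',
    P kp.1 kp.2 -> P kp.1.+1 p' /\ near kp.1 kp.2 p'.
  case: kp => k p /=; have [[pd Fp]|nP] := pselect (P k p); last by exists p.
  have h0 : 0 < d * 2^-1 ^+ k.+1 by rewrite mulr_gt0.
  have [p' [p'd Fp' dist]] := fitzpatrick_le_near Tg Tm TNI pd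
    (exprn_gt0 2 h0) Fp.
  exists p' => _; split=> //.
  set a := `|_| in dist *; set b := dnorm _ in dist *.
  have a0 : 0 <= a by exact: normr_ge0.
  have b0 : 0 <= b by exact: dnorm_ge0 (in_dual_sub p'd pd).
  (* With gap [e = d ^ 2 / 4 ^ k] and [eta = e / 4], the bound [4 (e + eta)] equals [5 e], which is
     at most [9 e]. *)
  have {dist} : a ^+ 2 + b ^+ 2 <= (3 * d * 2^-1 ^+ k) ^+ 2.
    apply: le_trans dist _; rewrite (exprS _ k).
    by move: (2^-1 ^+ k) => z; have := sqr_ge0 (d * z); lra.
  have t0 : 0 <= 3 * d * 2^-1 ^+ k by rewrite !mulr_ge0// ltW.
  move=> H; split; first exact: sqr_add_le a0 t0 H.
  by apply: sqr_add_le b0 t0 _; rewrite addrC; exact: H.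
have [g Hg] := choice step.
pose u := fix u k := if k is k'.+1 then g (k', u k') else c.
have uP k : P k (u k).
  elim: k => [|k IH]; first by rewrite /P expr0 mulr1.
  exact: (Hg (k, u k) IH).1.
have un k : near k (u k) (u k.+1) by exact: (Hg (k, u k) (uP k)).2.
have d3 : 0 <= 3 * d by lra.
have [a Ha] := geometric_step_cvg d3 (fun k => (un k).1).
(* The limit functional is built pointwise; the rate, proportional to the norm of [x], gives its
   continuity and the convergence in dual norm. *)
have Hx x : exists l, forall k, `|l - (u k).2 x| <= 6 * d * `|x| * 2^-1 ^+ k.
  have C0 : 0 <= 3 * d * `|x| by rewrite mulr_ge0.
  have [k|l Hl] := @geometric_step_cvg R R (fun k => (u k).2 x) _ C0.
    apply: le_trans (norm_le_dnorm x (in_dual_sub (uP k.+1).1 (uP k).1)) _.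
    by rewrite mulrAC ler_wpM2r//; exact: (un k).2.
  by exists l => k; rewrite (_ : 6 * d * _ = 2 * (3 * d * `|x|)); [exact: Hl|ring].
have [b Hb] := choice Hx.
have bd : in_dual b.
  apply: (@bounded_in_dual _ _ _ (6 * d + dnorm c.2)) => [t x y|x].
    apply/eqP; rewrite -subr_eq0 -normr_le0; apply/eqP/eqP.
    apply: (@le0_of_geometric _ _
      (6 * d * `|t *: x + y| + `|t| * (6 * d * `|x|) + 6 * d * `|y|)) => k.
    have := Hb (t *: x + y) k; rewrite (uP k).1.1 => H1.
    have := ler_wpM2l (normr_ge0 t) (Hb x k); rewrite -normrM => H2.
    have H3 := Hb y k.
    set A := _ - _ in H1; set B := t * _ in H2; set C := _ - _ in H3.
    rewrite (_ : _ - _ = A - B - C); last by rewrite /A /B /C; ring.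
    have := ler_normB (A - B) C; have := ler_normB A B; lra.
  have := Hb x 0%N; rewrite expr0 mulr1 /= => H.
  rewrite mulrDl -[b x](subrK (c.2 x)); apply: le_trans (ler_normD _ _) _.
  by rewrite lerD// norm_le_dnorm.
have bdist k : dnorm (fun x => b x - (u k).2 x) <= 6 * d * 2^-1 ^+ k.
  apply: dnorm_le_of_bound; first by rewrite !mulr_ge0 ?ltW.
  by move=> x; rewrite mulrAC; exact: Hb.
have adist k : `|a - (u k).1| <= 6 * d * 2^-1 ^+ k.
  by have := Ha k; rewrite (_ : 2 * (3 * d) = 6 * d)//; ring.
exists (a, b); last first.
  by split; [have := adist 0%N | have := bdist 0%N]; rewrite expr0 mulr1.
apply: maximal_monotone_mem => //; apply: fitzpatrick_le_closed => //= e e0.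
have e20 : 0 < e / 2 by lra.
have [h h0 Hh] := @pairing_continuous _ _ (a, b) _ bd e20.
have m0 : 0 < Num.min h e by rewrite lt_min h0.
(* The term [6 d] controls the distances, and [2 d ^ 2] brings the gap under [e / 2]; the other half
   pays for the variation of the pairing. *)
have [k] := geometric_half_lt (6 * d + 2 * d ^+ 2) m0.
rewrite lt_min => /andP[k1 k2].
have z0 := half0 k; have z1 : (2^-1 : R) ^+ k <= 1 by rewrite exprn_ile1//; lra.
have dz := mulr_ge0 (sqr_ge0 d) (ltW z0); have dz' := mulr_gt0 d0 z0.
have [ud Fu] := uP k; have Ha' := adist k; have Hb' := bdist k.
rewrite distrC in Ha'; rewrite dnorm_distC in Hb'.
exists (u k); split=> //.
- by lra.
- by lra.
- move=> q Tq; apply: le_trans (Fu _ Tq) _.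
  have := Hh (u k) ud; rewrite /= => /(_ ltac:(lra) ltac:(lra)).
  rewrite ltr_norml => /andP[_ H1].
  have := ler_wpM2l dz z1; lra.
Qed.


End BrondstedRockafellar.

(** * The upper epi-limit and its contact set with the pairing *)

Section LowerLimit.
Variables (R : realType) (X : completeNormedModType R) (Tn : nat -> operator X).
Implicit Types p q : X * (X -> R).

(* The epigraph of the upper epi-limit of the Fitzpatrick functions of the
   operators [Tn n]. *)
Definition epi_limsup_le p (r : R) : Prop :=
  forall e, 0 < e -> exists N, forall n, (N <= n)%N -> exists q,
    [/\ in_dual q.2, `|q.1 - p.1| < e, dnorm (fun x => q.2 x - p.2 x) < e &
        fitzpatrick_le (Tn n) q (r + e)].

(** The value is [+oo] where no real bound exists. *)
Definition epi_limsup p : \bar R := ereal_inf [set r%:E | r in epi_limsup_le p].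

Lemma epi_limsup_le_closed p r : in_dual p.2 ->
  (forall e, 0 < e -> exists q,
    [/\ in_dual q.2, `|q.1 - p.1| < e, dnorm (fun x => q.2 x - p.2 x) < e &
        epi_limsup_le q (r + e)]) ->
  epi_limsup_le p r.
Proof.
move=> pd H e e0; have e20 : 0 < e / 2 by lra.
have [q [qd q1 q2 Hq]] := H _ e20; have [N HN] := Hq _ e20.
exists N => n Nn; have [s [sd s1 s2 Fs]] := HN _ Nn.
exists s; split=> //.
- rewrite -(subrK q.1 s.1) -addrA; apply: le_lt_trans (ler_normD _ _) _; lra.
- apply: le_lt_trans (dnormB_le sd qd pd) _; lra.
- by rewrite (_ : r + e = r + e / 2 + e / 2)//; lra.
Qed.

(** Closedness of the epigraph, applied along the fibre over [p], shows that a finite infimum is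
    attained. *)
Lemma epi_limsup_leP p r : in_dual p.2 ->
  (epi_limsup p <= r%:E)%E <-> epi_limsup_le p r.
Proof.
move=> pd; split=> [H|H]; last by apply: ereal_inf_lbound; exists r.
apply: epi_limsup_le_closed => // e e0; exists p; split=> //.
- by rewrite subrr normr0.
- rewrite (_ : (fun _ => _) = fun=> 0) ?dnorm_zero//.
  by apply/funext => x; rewrite subrr.
have : (epi_limsup p < (r + e)%:E)%E.
  by apply: le_lt_trans H _; rewrite lte_fin; lra.
move=> /ereal_inf_lt[_ [s Hs <-]]; rewrite lte_fin => sr.
move=> d d0; have [N HN] := Hs _ d0; exists N => n /HN[q [qd q1 q2 Fq]].
by exists q; split=> // z Tz; apply: le_trans (Fq _ Tz) _; lra.
Qed.

(** At each level [a] this is the contrapositive of the closedness of the epigraph. *)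
Lemma epi_limsup_lsc : lsc_on_XXs epi_limsup.
Proof.
move=> p a pd; rewrite ltNge => /negP ap; apply: contrapT => H; apply: ap.
apply/epi_limsup_leP => //; apply: epi_limsup_le_closed => // e e0.
apply: contrapT => H'; apply: H; exists e => // q qd q1 q2.
rewrite ltNge; apply/negP => /(epi_limsup_leP _ qd) Hq; apply: H'.
exists q; split=> // d d0; have [N HN] := Hq _ d0; exists N => n /HN.
move=> [s [sd s1 s2 Fs]]; exists s; split=> // z Tz.
by apply: le_trans (Fs _ Tz) _; lra.
Qed.

Hypothesis TnD : forall n, type_D (Tn n).

Let Tn_graph n : graph_in_XXs (Tn n).
Proof. by have [[]] := TnD n. Qed.

Let Tn_NI n : type_NI (Tn n).
Proof. exact: type_D_NI. Qed.

(** Each Fitzpatrick function is above the pairing at points arbitrarily near [p], and the pairing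
    is continuous. *)
Lemma epi_limsup_le_pairing p r : in_dual p.2 ->
  epi_limsup_le p r -> p.2 p.1 <= r.
Proof.
move=> pd H; apply/ler_addgt0Pr => e e0; have e20 : 0 < e / 2 by lra.
have [d d0 Hd] := pairing_continuous pd e20.
have m0 : 0 < Num.min d (e / 2) by rewrite lt_min d0.
have [N /(_ N (leqnn N))[q [qd]]] := H _ m0.
rewrite !lt_min => /andP[q1 _] /andP[q2 _] Fq.
have := Hd _ qd q1 q2; rewrite ltr_norml => /andP[H1 _].
have := fitzpatrick_le_pairing (@Tn_graph N) (@Tn_NI N) qd Fq.
by have : Num.min d (e / 2) <= e / 2; [rewrite ge_min lexx orbT | lra].
Qed.

Lemma epi_limsup_ge_pairing p : in_dual p.2 -> ((p.2 p.1)%:E <= epi_limsup p)%E.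
Proof.
move=> pd; apply/ereal_infP => _ [r Hr <-].
by rewrite lee_fin; exact: epi_limsup_le_pairing.
Qed.

Lemma epi_limsup_le_convex p q r s t : in_dual p.2 -> in_dual q.2 ->
  0 < t < 1 -> epi_limsup_le p r -> epi_limsup_le q s ->
  epi_limsup_le
    (t *: p.1 + (1 - t) *: q.1, fun x => t * p.2 x + (1 - t) * q.2 x)
    (t * r + (1 - t) * s).
Proof.
move=> pd qd t01 Hp Hq e e0; have /andP[t0 t1] := t01.
have t1' : 0 < 1 - t by lra.
have [N HN] := Hp _ e0; have [M HM] := Hq _ e0.
exists (maxn N M) => n; rewrite geq_max => /andP[/HN[p' [p'd p1 p2 Fp]]].
move=> /HM[q' [q'd q1 q2 Fq]].
exists (t *: p'.1 + (1 - t) *: q'.1,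
  fun x => t * p'.2 x + (1 - t) * q'.2 x); split=> /=.
- exact: in_dual_comb p'd (in_dual_scale _ q'd).
- have -> : t *: p'.1 + (1 - t) *: q'.1 - (t *: p.1 + (1 - t) *: q.1) =
      t *: (p'.1 - p.1) + (1 - t) *: (q'.1 - q.1).
    by rewrite !scalerBr opprD addrACA.
  apply: le_lt_trans (ler_normD _ _) _; rewrite !normrZ !gtr0_norm//.
  have : t * `|p'.1 - p.1| < t * e by rewrite ltr_pM2l.
  have : (1 - t) * `|q'.1 - q.1| < (1 - t) * e by rewrite ltr_pM2l.
  by lra.
- have pp := in_dual_sub p'd pd; have qq := in_dual_sub q'd qd.
  have -> : (fun x => t * p'.2 x + (1 - t) * q'.2 x -
                      (t * p.2 x + (1 - t) * q.2 x)) =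
      (fun x => t * (p'.2 x - p.2 x) + (1 - t) * (q'.2 x - q.2 x)).
    by apply/funext => x; ring.
  apply: le_lt_trans (dnormD_le (in_dual_scale t pp) (in_dual_scale (1 - t) qq)) _.
  apply: le_lt_trans (lerD (dnormZ_le _ pp) (dnormZ_le _ qq)) _.
  rewrite !gtr0_norm//.
  set a := dnorm _ in p2 *; set b := dnorm _ in q2 *.
  have : t * a < t * e by rewrite ltr_pM2l.
  have : (1 - t) * b < (1 - t) * e by rewrite ltr_pM2l.
  by lra.
- have := fitzpatrick_le_convex (@Tn_graph n) t01 Fp Fq.
  by rewrite (_ : t * (r + e) + _ = t * r + (1 - t) * s + e)//; ring.
Qed.

Lemma epi_limsup_convex : convex_on_XXs epi_limsup.
Proof.
move=> p q t pd qd t01; have /andP[t0 t1] := t01.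
(* The lower bound by the pairing excludes the value [-oo]. *)
have := epi_limsup_ge_pairing pd; have := epi_limsup_ge_pairing qd.
case Ep : (epi_limsup p) => [a||] // Hq Hp; last first.
  rewrite gt0_muley ?lte_fin// addye ?leey//.
  case: (epi_limsup q) Hq => [b||] // _.
  by rewrite gt0_muley ?lte_fin//; lra.
case Eq : (epi_limsup q) Hq => [b||] // _; last first.
  by rewrite gt0_muley ?lte_fin ?addey ?leey//; lra.
have : epi_limsup_le p a by apply/epi_limsup_leP => //; rewrite Ep.
have : epi_limsup_le q b by apply/epi_limsup_leP => //; rewrite Eq.
move=> Hb Ha; rewrite -!EFinM -EFinD; apply/epi_limsup_leP => /=.
  exact: in_dual_comb pd (in_dual_scale _ qd).
exact: epi_limsup_le_convex.
Qed.

Lemma liminf_epi_limsup_le p : liminf_op Tn p -> epi_limsup_le p (p.2 p.1).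
Proof.
move=> [pd [y [Ty [y1 y2]]]] e e0.
have [d d0 Hd] := pairing_continuous pd e0.
have m0 : 0 < Num.min d e by rewrite lt_min d0.
have /cvgrPdist_lt/(_ _ m0)[N1 _ HN1] := y1.
have /cvgrPdist_lt/(_ _ m0)[N2 _ HN2] := y2.
exists (maxn N1 N2) => n; rewrite geq_max => /andP[/HN1 /= n1 /HN2 /= n2].
have yd := @Tn_graph n _ (Ty n).
rewrite distrC in n1; rewrite sub0r normrN in n2.
rewrite ger0_norm in n2; last exact: dnorm_ge0 (in_dual_sub yd pd).
move: n1 n2; rewrite !lt_min => /andP[n1 n1'] /andP[n2 n2'].
exists (y n); split=> // z Tz.
have [[_ [Tm _]] _] := TnD n.
apply: le_trans (fitzpatrick_le_graph (@Tn_graph n) Tm (Ty n) Tz) _.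
by have := Hd _ yd n1 n2; rewrite ltr_norml => /andP[]; lra.
Qed.

Definition gdist p q : R := `|q.1 - p.1| + dnorm (fun x => q.2 x - p.2 x).

Lemma epi_limsup_le_gdist p (e : R) : in_dual p.2 -> 0 < e ->
  epi_limsup_le p (p.2 p.1) ->
  exists N, forall n, (N <= n)%N -> exists2 q, Tn n q & gdist p q < e.
Proof.
(* Each component moves by less than [d] from [p] to [c] and by at most [6 d] from [c] to [q], in
   total less than [14 d < e]. *)
move=> pd e0 H; pose d := e / 15; have d0 : 0 < d by rewrite /d; lra.
have d20 : 0 < d ^+ 2 / 2 by rewrite divr_gt0// exprn_gt0.
have [h h0 Hh] := pairing_continuous pd d20.
have m0 : 0 < Num.min h (Num.min d (d ^+ 2 / 2)) by rewrite !lt_min h0 d0.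
have [N HN] := H _ m0; exists N => n /HN[c [cd]].
rewrite !lt_min => /and3P[c1 c1' _] /and3P[c2 c2' _] Fc.
have Fc' : fitzpatrick_le (Tn n) c (c.2 c.1 + d ^+ 2).
  move=> z Tz; apply: le_trans (Fc _ Tz) _.
  have : Num.min h (Num.min d (d ^+ 2 / 2)) <= d ^+ 2 / 2.
    by rewrite !ge_min lexx !orbT.
  have := Hh _ cd c1 c2; rewrite ltr_norml => /andP[]; lra.
have [q Tq [q1 q2]] := fitzpatrick_graph_dist (TnD n).1 (@Tn_NI n) cd d0 Fc'.
exists q => //; rewrite /gdist.
have qd := @Tn_graph n _ Tq.
have := dnormB_le qd cd pd; have := ler_normD (q.1 - c.1) (c.1 - p.1).
by rewrite addrA subrK; rewrite /d in c1' c2' q1 q2; lra.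
Qed.

Lemma epi_limsup_le_liminf p : in_dual p.2 ->
  epi_limsup_le p (p.2 p.1) -> liminf_op Tn p.
Proof.
move=> pd H; split=> //.
have gd0 n q : Tn n q -> 0 <= gdist p q.
  move=> Tq; rewrite addr_ge0// dnorm_ge0//.
  by apply: in_dual_sub => //; exact: Tn_graph Tq.
have half0 n : 0 < (2^-1 : R) ^+ n by rewrite exprn_gt0// invr_gt0.
(* Points of [Tn n] nearest to [p] up to [2 ^ - n] form one sequence that serves every [e]. *)
have nearest n : exists q, Tn n q /\
    forall z, Tn n z -> gdist p q <= gdist p z + 2^-1 ^+ n.
  have Tn0 : Tn n !=set0.
    have [q Tq _] := @Tn_NI n _ _ (in_bidual_eval 0) (in_dual_zero X) _ ltr01.
    by exists q.
  have [q Tq Hq] := inf_image_near Tn0 (gd0 n) (half0 n).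
  exists q; split=> // z Tz; apply: le_trans (ltW Hq) _.
  by rewrite lerD2r; apply: (inf_image_le (gd0 n)).
have [y Hy] := choice nearest.
have small e : 0 < e -> \forall n \near \oo, gdist p (y n) < e.
  move=> e0; have e20 : 0 < e / 2 by lra.
  have [N HN] := epi_limsup_le_gdist pd e20 H.
  have [M HM] := geometric_half_lt 1 e20.
  exists (maxn N M) => // n /=; rewrite geq_max => /andP[/HN[z Tz zl] Mn].
  have := (Hy n).2 _ Tz.
  have : (2^-1 : R) ^+ n <= 2^-1 ^+ M by rewrite ler_wiXn2l//; lra.
  by lra.
exists y; split; first by move=> n; exact: (Hy n).1.
have yd n : in_dual (fun x => (y n).2 x - p.2 x).
  by apply: in_dual_sub => //; exact: Tn_graph (Hy n).1.
split; apply/cvgrPdist_lt => e e0; near=> n.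
  rewrite distrC; apply: (@le_lt_trans _ _ (gdist p (y n))).
    by rewrite /gdist lerDl dnorm_ge0.
  by near: n; exact: small.
rewrite sub0r normrN ger0_norm ?dnorm_ge0//.
apply: (@le_lt_trans _ _ (gdist p (y n))); first by rewrite /gdist lerDr.
by near: n; exact: small.
Unshelve. all: by end_near. Qed.

End LowerLimit.

(** * Representability of the empty operator *)

Section EmptyOperator.
Variables (R : realType) (X : completeNormedModType R).

(** The pairing vanishes at the origin, so the value 1 keeps the function proper and strictly above
    the pairing. *)
Definition origin_indicator1 (p : X * (X -> R)) : \bar R :=
  if `[< p.1 = 0 /\ p.2 = fun=> 0 >] then 1%E else +oo%E.

Lemma representable_empty (T : operator X) : ~ (T !=set0) -> representable T.
Proof.
move=> T0; have noT p : ~ T p by move=> Tp; apply: T0; exists p.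
split=> [p /noT//|]; exists origin_indicator1.
have ge1 p : (1 <= origin_indicator1 p)%E.
  by rewrite /origin_indicator1; case: ifP => // _; rewrite leey.
have at0 : origin_indicator1 (0, fun=> 0) = 1%E.
  by rewrite /origin_indicator1; case: asboolP => // -[].
split; [|split; [|split; [|split]]].
- move=> p q t pd qd /andP[t0 t1]; have t1' : 0 < 1 - t by lra.
  have [[p1 p2]|np] := pselect (p.1 = 0 /\ p.2 = fun=> 0); last first.
    rewrite {2}/origin_indicator1; case: asboolP => // _.
    rewrite gt0_muley ?lte_fin// addye ?leey//.
    rewrite /origin_indicator1; case: ifP => _; first by rewrite mule1.
    by rewrite gt0_muley ?lte_fin.
  have [[q1 q2]|nq] := pselect (q.1 = 0 /\ q.2 = fun=> 0); last first.
    rewrite {3}/origin_indicator1; case: asboolP => // _.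
    rewrite [((1 - t)%:E * _)%E]gt0_muley ?lte_fin// addey ?leey//.
    rewrite /origin_indicator1; case: ifP => _; first by rewrite mule1.
    by rewrite gt0_muley ?lte_fin.
  rewrite p1 p2 q1 q2 !scaler0 addr0.
  rewrite (_ : (fun _ => _) = fun=> 0); last by apply/funext => x; ring.
  rewrite (surjective_pairing p) (surjective_pairing q) p1 p2 q1 q2 at0.
  by rewrite !mule1 -EFinD lee_fin; lra.
- split; last by exists (0, fun=> 0); split; [exact: in_dual_zero | rewrite at0].
  by move=> p _; rewrite gt_eqF// (lt_le_trans _ (ge1 p))// ltNyr.
- move=> p a pd; rewrite {1}/origin_indicator1; case: asboolP => [_ a1|np _].
    by exists 1 => // q _ _ _; exact: lt_le_trans a1 (ge1 q).
  (* The norm of a nonzero component of [p] is a radius that leaves the origin out. *)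
  have [p1|p1] := pselect (p.1 = 0); last first.
    exists `|p.1|; first by rewrite normr_gt0; exact/eqP.
    move=> q _ + _; rewrite /origin_indicator1; case: asboolP => [[-> _]|_].
      by rewrite sub0r normrN ltxx.
    by rewrite ltry.
  exists (dnorm p.2).
    rewrite lt_neqAle dnorm_ge0// andbT eq_sym; apply/eqP => d0; apply: np.
    split=> //; apply/funext => x; apply/eqP; rewrite -normr_le0.
    by have := norm_le_dnorm x pd; rewrite d0 mul0r.
  move=> q _ _; rewrite /origin_indicator1; case: asboolP => [[_ ->]|_].
    rewrite dnorm_distC (_ : (fun x => p.2 x - 0) = p.2) ?ltxx//.
    by apply/funext => x; rewrite subr0.
  by rewrite ltry.
- move=> p pd; rewrite /origin_indicator1; case: asboolP => [[-> ->]|_].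
    by rewrite lee_fin.
  by rewrite leey.
- move=> p pd; split=> [/noT//|]; rewrite /origin_indicator1.
  by case: asboolP => [[-> ->] [] /eqP|_ //]; rewrite oner_eq0.
Qed.

End EmptyOperator.

Theorem theorem3p3 (R : realType) (X : completeNormedModType R)
  (Tn : nat -> operator X) :
  (forall n, type_D (Tn n)) -> representable (liminf_op Tn).
Proof.
(* A point of the lower limit gives the finite value that properness requires. *)
move=> TnD; have [[p0 Tp0]|T0] := pselect (liminf_op Tn !=set0); last first.
  exact: representable_empty.
split=> [p []//|]; exists (epi_limsup Tn).
have memP p : in_dual p.2 -> liminf_op Tn p <-> epi_limsup Tn p = (p.2 p.1)%:E.
  move=> pd; split=> [/(liminf_epi_limsup_le TnD) Hp|Hp].
    apply/eqP; rewrite eq_le epi_limsup_ge_pairing// andbT.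
    exact/epi_limsup_leP.
  by apply: epi_limsup_le_liminf => //; apply/epi_limsup_leP => //; rewrite Hp.
split; [exact: epi_limsup_convex|split; [|split; [exact: epi_limsup_lsc|split]]].
- split=> [p pd|].
    by rewrite gt_eqF// (lt_le_trans _ (epi_limsup_ge_pairing TnD pd))// ltNyr.
  have pd0 := Tp0.1.
  by exists p0; split=> //; rewrite (iffLR (memP _ pd0) Tp0).
- by move=> p pd; exact: epi_limsup_ge_pairing.
- exact: memP.
Qed.
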